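(* Any random field is restored by its full one-point conditional distribution. That is, if $P$ and $P'$ are (positive) random fields and there is a system $Q_1=\{Q_t^z, z\in\widehat{X_t}, t\in\mathbb{Z}^d\}$ which is a full one-point conditional distribution both of $P$ and of $P'$, then $P=P'$.
   Context: $X\subset\mathbb{R}$ is a finite set with $1<|X|<\infty$, and $d\ge 1$. For $S\subset\mathbb{Z}^d$, $W(S)$ is the set of all finite subsets of $S$, and $W=W(\mathbb{Z}^d)$. $X^S$ is the set of configurations on $S$ (functions $S\to X$); braces are omitted for one-point sets, e.g. $X^t=X^{\{t\}}$. For disjoint $S,T$ and $x\in X^S$, $y\in X^T$, $xy\in X^{S\cup T}$ is the concatenation; $z_\Lambda$ is the restriction of $z$ to $\Lambda$. For $t\in\mathbb{Z}^d$, $\widehat{X_t}=\bigcup_{\emptyset\neq S\subset\mathbb{Z}^d\setminus\{t\}}X^S$ (configurations with nonempty, finite or infinite, support not containing $t$). A random field is a probability measure $P$ on $X^{\mathbb{Z}^d}$ with the $\sigma$-algebra generated by cylinder sets; $P_S$ denotes its marginal on $X^S$, $S\subset\mathbb{Z}^d$. All random fields are assumed positive: $P_V(x)>0$ for all $V\in W$, $x\in X^V$. A full one-point conditional distribution of $P$ is a system $Q_1(P)=\{Q_t^z, z\in\widehat{X_t}, t\in\mathbb{Z}^d\}$ of probability distributions $Q_t^z$ on $X^t$ consisting of one-point conditional probabilities of $P$: for $z\in X^S$ with $\emptyset\neq S\in W(\mathbb{Z}^d\setminus\{t\})$ finite, $Q_t^z(x)=P_{\{t\}\cup S}(xz)/P_S(z)$;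 and for infinite $S\subset\mathbb{Z}^d\setminus\{t\}$ and $P_S$-almost every $z\in X^S$, $Q_t^z(x)=\lim_{n\to\infty}P_{\{t\}\cup\Lambda_n}(xz_{\Lambda_n})/P_{\Lambda_n}(z_{\Lambda_n})$, $x\in X^t$, for any increasing sequence of nonempty finite sets $\Lambda_n$ with $\bigcup_n\Lambda_n=S$ (the exceptional null set may depend on $t$, $S$ and the sequence); for the remaining infinite boundary conditions $z$ the distribution $Q_t^z$ is arbitrary. *)

(* Defs.v *)
From HB Require Import structures.
From mathcomp Require Import all_boot all_order all_algebra finmap.
From mathcomp Require Import all_classical all_reals all_analysis.

Set Implicit Arguments.
Unset Strict Implicit.
Unset Printing Implicit Defensive.

Import Order.TTheory GRing.Theory Num.Theory.

Local Open Scope classical_set_scope.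
Local Open Scope ring_scope.

Notation site d := 'rV[int]_d.

(* The bound on the cardinality is bundled because the library's measurable
   types have to be pointed, hence so do the configuration spaces. *)
Record alphabet (R : realType) := Alphabet {
  alphabet_set :> {fset R};
  alphabet_gt1 : (1 < #|` alphabet_set|)%N }.

Definition letter (R : realType) (X : alphabet R) : Type :=
  fset_sub_type (alphabet_set X).

Fact letter_inhabited (R : realType) (X : alphabet R) :
  exists _ : letter X, True.
Proof.
case: (fset_0Vmem X) => [X0|[a aX]]; last by exists (FSetSub aX).
by have := alphabet_gt1 X; rewrite X0 cardfs0.
Qed.

HB.instance Definition _ (R : realType) (X : alphabet R) :=
  Finite.copy (letter X) (fset_sub_type (alphabet_set X)).
HB.instance Definition _ (R : realType) (X : alphabet R) :=
  isPointed.Build (letter X) (projT1 (cid (letter_inhabited X))).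

Definition config (R : realType) (X : alphabet R) (d : nat)
  (S : set (site d)) : Type := S -> letter X.

HB.instance Definition _ (R : realType) (X : alphabet R) (d : nat)
    (S : set (site d)) :=
  Pointed.copy (config X S) (S -> letter X).

Definition sub_site (d : nat) (A B : set (site d)) (AB : A `<=` B) (s : A) : B :=
  exist _ (val s) (mem_set (AB _ (set_mem (valP s)))).

Definition restr (R : realType) (X : alphabet R) (d : nat) (A B : set (site d))
    (AB : A `<=` B) (z : config X B) : config X A :=
  fun s => z (sub_site AB s).

Definition cylinders (R : realType) (X : alphabet R) (d : nat)
    (S : set (site d)) : set (set (config X S)) :=
  [set C | exists (L : set (site d)) (LS : L `<=` S) (B : set (config X L)),
             finite_set L /\ C = restr LS @^-1` B].

HB.instance Definition _ (R : realType) (X : alphabet R) (d : nat)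
    (S : set (site d)) :=
  Measurable.copy (config X S) (g_sigma_algebraType (@cylinders R X d S)).

Lemma measurable_restr (R : realType) (X : alphabet R) (d : nat)
    (A B : set (site d)) (AB : A `<=` B) :
  measurable_fun setT (@restr R X d A B AB).
Proof.
apply: (@measurability _ _ _ _ _ _ (@cylinders R X d A)) => //.
move=> _ [_ [L [LA [C [finL ->]]] <-]]; rewrite setTI.
apply: sub_sigma_algebra; exists L, (subset_trans LA AB), C; split => //.
apply/seteqP; split=> z /=; set u := restr _ _; set v := restr _ _;
  suff -> : u = v by []; apply/funext => s; rewrite /u /v /restr;
  by congr (z _); apply/val_inj.
Qed.

HB.instance Definition _ (R : realType) (X : alphabet R) (d : nat)
    (A B : set (site d)) (AB : A `<=` B) :=
  isMeasurableFun.Build _ _ _ _ (@restr R X d A B AB)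
    (@measurable_restr R X d A B AB).

Definition random_field (R : realType) (X : alphabet R) (d : nat) :=
  probability (config X [set: site d]) R.

Definition marginal (R : realType) (X : alphabet R) (d : nat)
    (P : random_field X d) (S : set (site d)) : probability (config X S) R :=
  distribution P (@restr R X d S setT (@subsetT _ S)).

(* Positivity is kept apart from the type of random fields. *)
Definition positive_field (R : realType) (X : alphabet R) (d : nat)
    (P : random_field X d) : Prop :=
  forall (V : set (site d)) (x : config X V),
    finite_set V -> (0 < marginal P V [set x])%E.

Fact setU_nleft (d : nat) (S T : set (site d)) (s : site d) :
  (S `|` T) s -> ~ S s -> T s.
Proof. by case. Qed.

(* Only used for disjoint [S] and [T]; on an overlap [x] would prevail. *)
Definition concat (R : realType) (X : alphabet R) (d : nat)
    (S T : set (site d)) (x : config X S) (y : config X T) :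
    config X (S `|` T) :=
  fun s => match pselect (S (val s)) with
           | left h => x (exist _ (val s) (mem_set h))
           | right h =>
               y (exist _ (val s)
                    (mem_set (setU_nleft (set_mem (valP s)) h)))
           end.

Record boundary (R : realType) (X : alphabet R) (d : nat) (t : site d) :=
  Boundary {
    supp : set (site d);
    supp_neq0 : supp !=set0;
    supp_notin : ~ supp t;
    bconf : config X supp }.

Arguments bconf {R X d t} b.

Definition onepoint_system (R : realType) (X : alphabet R) (d : nat) :=
  forall t : site d, boundary X t -> probability (config X [set t]) R.

Definition cond_ratio (R : realType) (X : alphabet R) (d : nat)
    (P : random_field X d) (t : site d) (S : set (site d))
    (x : config X [set t]) (z : config X S) : \bar R :=
  (marginal P ([set t] `|` S) [set concat x z] / marginal P S [set z])%E.

(* [L] is nondecreasing, not necessarily strictly; since [S] is infinite this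
   makes no difference to the limits.  The null set in the last clause may
   depend on [t], [S] and [L], and [Q] is unconstrained on it. *)
Definition is_full_onepoint_cond (R : realType) (X : alphabet R) (d : nat)
    (P : random_field X d) (Q : onepoint_system X d) : Prop :=
  (forall (t : site d) (z : boundary X t) (x : config X [set t]),
     finite_set (supp z) -> Q t z [set x] = cond_ratio P x (bconf z))
  /\
  (forall (t : site d) (S : set (site d)) (S0 : S !=set0) (St : ~ S t)
      (L : nat -> set (site d)) (LS : forall n, L n `<=` S),
     infinite_set S ->
     (forall n, finite_set (L n) /\ L n !=set0) ->
     (forall m n, (m <= n)%N -> L m `<=` L n) ->
     \bigcup_n L n = S ->
     {ae marginal P S, forall z : config X S, forall x : config X [set t],
        cond_ratio P x (restr (LS n) z) @[n --> \oo]
          --> Q t (Boundary S0 St z) [set x]}).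

(* Main.v *)
Require Import Defs.
From mathcomp Require Import all_boot all_order all_algebra finmap.
From mathcomp Require Import all_classical all_reals all_analysis.

Local Open Scope classical_set_scope.

Set Implicit Arguments.
Unset Strict Implicit.
Unset Printing Implicit Defensive.

Import Order.TTheory GRing.Theory Num.Theory.

(** A random field is determined by its probabilities of finite patterns, so
    the point is to recover those from the one-point conditional
    probabilities.  The chain rule
      P_{t,S}(xz) = Q_t^z(x) P_S(z)
    adds one site at a time to a nonempty finite support, and therefore
    reduces the task to one-site patterns.  It does not reach these, since a
    conditional distribution always has a nonempty boundary condition; this is
    where positivity and the existence of two distinct sites s and t enter.
    Expanding the probability of a pattern on {s, t} in both orders gives
      Q_t^z(x) P_s(z) = Q_s^x(z) P_t(x),
    and likewise for P', with the same positive coefficients.  Hence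
      P_t(x) P'_s(z) = P'_t(x) P_s(z)    for all letters x at t and z at s,
    and summing over x, where both P_t and P'_t have total mass 1, yields
    P'_s = P_s.

    The lemmas that carry the argument are [chain_rule],
    [pattern_prob_set1_eq] (one site), [pattern_prob_eq] (finite supports) and
    [random_field_eq] (from finite patterns to all measurable sets). *)

(** Configurations on different supports have different types.  Writing all of
    them as restrictions of one function [w] on the sites makes concatenation
    and changes of support, such as commuting a union, harmless. *)
Definition pattern (R : realType) (X : alphabet R) (d : nat)
    (V : set (site d)) (w : site d -> letter X) : config X V :=
  fun s => w (val s).

Arguments pattern {R X d} V w.

(** Shows that every configuration on [V] is a pattern; the letter chosen
    outside [V] is arbitrary. *)
Definition extension (R : realType) (X : alphabet R) (d : nat)
    (V : set (site d)) (z : config X V) : site d -> letter X :=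
  fun s => if pselect (V s) is left h then z (exist _ s (mem_set h)) else point.

Lemma extensionK (R : realType) (X : alphabet R) (d : nat) (V : set (site d))
    (z : config X V) : pattern V (extension z) = z.
Proof.
apply/funext => s; rewrite /pattern /extension.
case: pselect => [h|]; last by case; exact: (set_mem (valP s)).
by congr (z _); exact: val_inj.
Qed.

Lemma concat_pattern (R : realType) (X : alphabet R) (d : nat)
    (S T : set (site d)) (w : site d -> letter X) :
  concat (pattern S w) (pattern T w) = pattern (S `|` T) w.
Proof. by apply/funext => s; rewrite /concat; case: pselect. Qed.

Lemma pattern_eq (R : realType) (X : alphabet R) (d : nat)
    (V : set (site d)) (w w' : site d -> letter X) :
  {in V, w =1 w'} -> pattern V w = pattern V w'.
Proof. by move=> ww'; apply/funext => s; exact: ww' (valP s). Qed.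

Lemma restr_comp (R : realType) (X : alphabet R) (d : nat)
    (A B C : set (site d)) (AB : A `<=` B) (BC : B `<=` C) (AC : A `<=` C)
    (z : config X C) : restr AB (restr BC z) = restr AC z.
Proof. by apply/funext => s; congr (z _); exact: val_inj. Qed.

Lemma restr_id (R : realType) (X : alphabet R) (d : nat)
    (A : set (site d)) (AA : A `<=` A) (z : config X A) : restr AA z = z.
Proof. by apply/funext => s; congr (z _); exact: val_inj. Qed.

(** There are finitely many letters, and a configuration on [V] is encoded by
    a function on the finite type of the entries of a list enumerating [V]. *)
Lemma finite_config (R : realType) (X : alphabet R) (d : nat)
    (V : set (site d)) (A : set (config X V)) : finite_set V -> finite_set A.
Proof.
move=> /finite_seqP[r Vr]; have memV s : s \in V -> s \in r.
  by rewrite Vr inE.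
pose f (z : config X V) : {ffun seq_sub r -> letter X} :=
  [ffun s => extension z (ssval s)].
apply: (@sub_finite_set _ _ (f @^-1` setT)) => //.
apply: finite_preimage; last exact: finite_finset.
move=> z z' _ _ fzz'; rewrite -(extensionK z) -(extensionK z').
apply: pattern_eq => s /memV sr.
by have := congr1 (fun g : {ffun _ -> _} => g (SeqSub sr)) fzz'; rewrite !ffunE.
Qed.

(** Every set of configurations on [V] is the cylinder over itself. *)
Lemma measurable_config (R : realType) (X : alphabet R) (d : nat)
    (V : set (site d)) (A : set (config X V)) : finite_set V -> measurable A.
Proof.
move=> finV; apply: sub_sigma_algebra; exists V, (@subset_refl _ V), A.
by split=> //; apply/seteqP; split=> z /=; rewrite restr_id.
Qed.

(** On a finite support the configuration space is finite and discrete, so a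
    measure is the sum of its atoms. *)
Lemma measure_config (R : realType) (X : alphabet R) (d : nat)
    (V : set (site d)) (mu : probability (config X V) R)
    (A : set (config X V)) : finite_set V ->
  mu A = (\sum_(z \in A) mu [set z])%E.
Proof.
move=> finV; have finA := finite_config A finV.
rewrite -measure_fin_bigcup //.
- by congr (mu _); rewrite bigcup_imset1 image_id.
- by move=> z z' _ _ [y [/= -> ->]].
- by move=> z _; exact: measurable_config.
Qed.

(** The cylinders form a generating family stable under intersection, and the
    probability of a cylinder is a finite sum of pattern probabilities. *)
Lemma random_field_eq (R : realType) (X : alphabet R) (d : nat)
    (P P' : random_field X d) :
    (forall (V : set (site d)) (z : config X V), finite_set V ->
       marginal P V [set z] = marginal P' V [set z]) ->
  forall A : set (config X [set: site d]), measurable A -> P A = P' A.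
Proof.
move=> PP' A mA.
apply: (measure_unique (@cylinders R X d setT) (fun=> setT)) => //.
- move=> _ _ [L [LT [B [finL ->]]]] [M [MT [C [finM ->]]]].
  exists (L `|` M), (@subsetT _ (L `|` M)).
  exists ((restr (@subsetUl _ L M)) @^-1` B
            `&` (restr (@subsetUr _ L M)) @^-1` C).
  split; first by rewrite finite_setU.
  by apply/seteqP; split=> z /= [];
    rewrite !(restr_comp _ _ LT) !(restr_comp _ _ MT).
- move=> _; exists set0, (@subsetT _ set0), setT; split => //.
- by rewrite bigcup_const//; exists 0%N.
- move=> _ [L [LT [B [finL ->]]]].
  have marginalE (P0 : random_field X d) :
      P0 (restr LT @^-1` B) = marginal P0 L B.
    by rewrite (Prop_irrelevance LT (@subsetT _ L)).
  transitivity (marginal P L B); first exact: marginalE.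
  transitivity (marginal P' L B); last exact/esym/marginalE.
  rewrite !measure_config//.
  by apply: eq_fsbigr => z _; exact: PP'.
- by move=> _; rewrite [ltLHS](probability_setT P) ltry.
Qed.

Definition pattern_prob (R : realType) (X : alphabet R) (d : nat)
    (P : random_field X d) (V : set (site d)) (w : site d -> letter X) : R :=
  fine (marginal P V [set pattern V w]).

Lemma pattern_probE (R : realType) (X : alphabet R) (d : nat)
    (P : random_field X d) (V : set (site d)) (w : site d -> letter X) :
  finite_set V ->
  marginal P V [set pattern V w] = (pattern_prob P V w)%:E.
Proof.
move=> finV; rewrite fineK// fin_num_measure//; exact: measurable_config.
Qed.

Lemma pattern_prob_gt0 (R : realType) (X : alphabet R) (d : nat)
    (P : random_field X d) (V : set (site d)) (w : site d -> letter X) :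
  positive_field P -> finite_set V -> (0 < pattern_prob P V w)%R.
Proof. by move=> Ppos finV; rewrite -lte_fin -pattern_probE//; exact: Ppos. Qed.

Lemma pattern_prob_local (R : realType) (X : alphabet R) (d : nat)
    (P : random_field X d) (V : set (site d)) (w w' : site d -> letter X) :
  {in V, w =1 w'} -> pattern_prob P V w = pattern_prob P V w'.
Proof. by move=> ww'; rewrite /pattern_prob (pattern_eq ww'). Qed.

(** The one-site patterns at [t] partition the configurations on [t]. *)
Lemma sum_letter_prob (R : realType) (X : alphabet R) (d : nat)
    (P : random_field X d) (t : site d) :
  (\sum_(a : letter X) pattern_prob P [set t] (fun=> a) = 1)%R.
Proof.
apply: EFin_inj; rewrite -sumEFin -(probability_setT (marginal P [set t])).
under eq_bigr do rewrite -pattern_probE//.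
transitivity (\sum_(a \in [set: letter X])
    marginal P [set t] [set pattern [set t] (fun=> a)])%E.
  rewrite (fsbig_seq _ _ (index_enum_uniq _)).
  suff -> : [set` index_enum (letter X)] = setT by [].
  by apply/seteqP; split=> // a _ /=; rewrite mem_index_enum.
rewrite -measure_fin_bigcup//.
- congr (marginal _ _ _); apply/seteqP; split=> // z _.
  exists (extension z t) => //=; rewrite -{1}(extensionK z).
  by apply: pattern_eq => s; rewrite inE => /= ->.
- exact: finite_finset.
- move=> a b _ _ [z [/= -> ab]].
  by have := congr1 (fun y => y (exist _ t (mem_set erefl))) ab.
- by move=> a _; exact: measurable_config.
Qed.

(** The definition of conditional probability, multiplied out: the coefficient
    is read off [Q] and hence is the same for all fields with conditional
    distribution [Q]. *)
Lemma chain_rule (R : realType) (X : alphabet R) (d : nat)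
    (P : random_field X d) (Q : onepoint_system X d)
    (t : site d) (S : set (site d)) (S0 : S !=set0) (St : ~ S t)
    (w : site d -> letter X) :
  positive_field P -> is_full_onepoint_cond P Q -> finite_set S ->
  pattern_prob P ([set t] `|` S) w =
  (fine (Q t (Boundary S0 St (pattern S w)) [set pattern [set t] w])
   * pattern_prob P S w)%R.
Proof.
move=> Ppos [QP _] finS; rewrite QP//= /cond_ratio concat_pattern.
have finU : finite_set ([set t] `|` S) by rewrite finite_setU.
have pS0 : pattern_prob P S w != 0%R by rewrite gt_eqF// pattern_prob_gt0.
by rewrite !pattern_probE//= inver (negbTE pS0) -EFinM /= divfK.
Qed.

Lemma other_site (d : nat) (t : site d) : (1 <= d)%N -> exists s, s != t.
Proof.
case: d t => // d t _; exists (t + const_mx 1)%R.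
apply/eqP => /(congr1 (fun u : 'rV_d.+1 => u ord0 ord0)); rewrite !mxE.
by move=> /(canRL (addKr _)); rewrite addNr.
Qed.

(** The base case that the chain rule cannot provide.  A second site [t] is
    used to compare the two fields: the ratio of their one-site probabilities
    at [s] is the same as at [t], whatever the letters there, so it is
    constant, and it is 1 because probabilities sum to 1. *)
Lemma pattern_prob_set1_eq (R : realType) (X : alphabet R) (d : nat)
    (P P' : random_field X d) (Q : onepoint_system X d) (s : site d)
    (w : site d -> letter X) :
  (1 <= d)%N -> positive_field P -> positive_field P' ->
  is_full_onepoint_cond P Q -> is_full_onepoint_cond P' Q ->
  pattern_prob P [set s] w = pattern_prob P' [set s] w.
Proof.
move=> d1 Ppos P'pos QP QP'; have [t ts] := other_site s d1.
have St : ~ [set s] t by move/eqP; rewrite (negbTE ts).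
have Ts : ~ [set t] s by move=> /= st; rewrite st eqxx in ts.
have s0 : [set s] !=set0 by exists s.
have t0 : [set t] !=set0 by exists t.
have cross v : (pattern_prob P [set t] v * pattern_prob P' [set s] v =
    pattern_prob P' [set t] v * pattern_prob P [set s] v)%R.
  (* The probability of the pattern on both sites, expanded in both orders. *)
  have Pst := chain_rule s0 St v Ppos QP (finite_set1 s).
  have Pts := chain_rule t0 Ts v Ppos QP (finite_set1 t).
  have P'st := chain_rule s0 St v P'pos QP' (finite_set1 s).
  have P'ts := chain_rule t0 Ts v P'pos QP' (finite_set1 t).
  set q := fine _ in Pst P'st; set r := fine _ in Pts P'ts.
  rewrite setUC in Pst; rewrite setUC in P'st.
  have pair_gt0 : (0 < pattern_prob P ([set s] `|` [set t]) v)%R.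
    by apply: pattern_prob_gt0 => //; rewrite finite_setU.
  have q0 : q != 0%R.
    by apply: contraTneq pair_gt0 => q0; rewrite Pst q0 mul0r ltxx.
  have r0 : r != 0%R.
    by apply: contraTneq pair_gt0 => r0; rewrite Pts r0 mul0r ltxx.
  apply: (mulfI (mulf_neq0 r0 q0)).
  by rewrite mulrACA [RHS]mulrACA -Pts -P'ts -P'st -Pst mulrC.
have sum_cross : (\sum_(a : letter X) pattern_prob P [set t] (fun=> a)
      * pattern_prob P' [set s] w =
    \sum_(a : letter X) pattern_prob P' [set t] (fun=> a)
      * pattern_prob P [set s] w)%R.
  (* Cross-multiplication holds for one function on both sites; [v] has the
     letter [a] at [t] and agrees with [w] at [s]. *)
  apply: eq_bigr => a _; pose v u := if u == t then a else w u.
  have va : {in [set t], v =1 fun=> a}.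
    by move=> u; rewrite inE => /= ->; rewrite /v eqxx.
  have vw : {in [set s], v =1 w}.
    by move=> u; rewrite inE => /= ->; rewrite /v eq_sym (negbTE ts).
  by rewrite -!(pattern_prob_local _ va) -!(pattern_prob_local _ vw).
by move: sum_cross; rewrite -!big_distrl /= !sum_letter_prob !mul1r.
Qed.

(** Sites are added one at a time by the chain rule, starting from a single
    one. *)
Lemma pattern_prob_eq (R : realType) (X : alphabet R) (d : nat)
    (P P' : random_field X d) (Q : onepoint_system X d) (V : set (site d))
    (w : site d -> letter X) :
  (1 <= d)%N -> positive_field P -> positive_field P' ->
  is_full_onepoint_cond P Q -> is_full_onepoint_cond P' Q ->
  finite_set V -> pattern_prob P V w = pattern_prob P' V w.
Proof.
move=> d1 Ppos P'pos QP QP' /finite_seqP[r ->{V}].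
elim: r => [|t r IHr].
  (* There is one configuration on the empty support, of probability 1. *)
  have all0 : [set pattern [set` [::]] w] = [set: config X [set` [::]]].
    apply/seteqP; split=> // z _; apply/funext => s.
    by have := set_mem (valP s).
  by rewrite /pattern_prob all0 !probability_setT.
have -> : [set` t :: r] = [set t] `|` [set` r].
  apply/seteqP; split=> s /=; rewrite inE.
    by move=> /predU1P[]; [left|right].
  by case=> [->|->]; rewrite ?eqxx ?orbT.
have [rt|rt] := pselect ([set` r] t).
  by rewrite (setUidr (_ : [set t] `<=` _))// => _ ->.
have [->|r0] := eqVneq r [::].
  by rewrite classical_sets.set_nil setU0; exact: pattern_prob_set1_eq QP QP'.
have S0 : [set` r] !=set0.
  by case: r r0 {IHr rt} => // s r _; exists s; rewrite /= mem_head.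
by rewrite (chain_rule S0 rt w Ppos QP)// (chain_rule S0 rt w P'pos QP')// IHr.
Qed.

(* Equality of measures is equality on the sigma-algebra: a library measure is
   a function on all subsets, unconstrained on the non-measurable ones. *)
Theorem theorem14 (R : realType) (X : alphabet R) (d : nat) (hd : (1 <= d)%N)
  (P P' : random_field X d)
  (Ppos : positive_field P) (P'pos : positive_field P')
  (Q : onepoint_system X d)
  (QP : is_full_onepoint_cond P Q) (QP' : is_full_onepoint_cond P' Q)
  (A : set (config X [set: site d])) (mA : measurable A) :
  P A = P' A.
Proof.
apply: (random_field_eq _ mA) => V z finV.
rewrite -(extensionK z) !pattern_probE//; congr EFin.
exact: pattern_prob_eq QP QP' finV.
Qed.
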